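(* There exist a universal constant $C>0$ and an integer $n_0$ such that, for every $n\ge n_0$ and every origin-symmetric set $T_n\subset\mathbb{R}^n$ satisfying $\{-1,1\}^n\subset T_n\subset(2\mathbb{Z}+1)^n$, one has $$\frac{\widetilde{w}(T_n)}{r(T_n)}\ge C\sqrt{\log n},$$ where $\widetilde{w}(T_n)$ is the focused width of $T_n$ and $r(T_n)$ is the (Gaussian) detectability radius of $T_n$.
   Context: A set $S\subset\mathbb{R}^n$ is origin-symmetric if $S=-S$. $2\mathbb{Z}+1$ is the set of odd integers. $\gamma_n$ denotes the standard Gaussian measure on $\mathbb{R}^n$, and for $A,T\subset\mathbb{R}^n$ and $r>0$, $A-rT:=\{x-rt: x\in A,\ t\in T\}$. Detectability radius: for $T\subset\mathbb{R}^n$, a scale $r>0$ is called detectable for $T$ if there exists a measurable set $A\subset\mathbb{R}^n$ with $$\gamma_n(A)\ge 0.9\quad\text{and}\quad \gamma_n(A-rT)\le 0.1.$$ The detectability radius is $$r(T):=\sup\{r>0:\ \text{there is no measurable } A\subset\mathbb{R}^n \text{ with } \gamma_n(A)\ge 0.9 \text{ and } \gamma_n(A-rT)\le 0.1\}.$$ Focused width: for $S\subset\mathbb{R}^n$ let $w(S):=\mathbb{E}\sup_{u\in S}\langle g,u\rangle$ with $g\sim N(0,I_n)$ (possibly $+\infty$). For $T\subset\mathbb{R}^n$, $$\widetilde{w}(T):=\inf_S w(S),$$ where the infimum is over all origin-symmetric sets $S\subset\mathbb{R}^n$ satisfying the hitting condition: for every $t\in T$ there exists $u\in S$ with $\langle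 t,u\rangle\ge 1$. *)

(* Defs.v *)
From HB Require Import structures.
From mathcomp Require Export all_boot all_order all_algebra.
From mathcomp Require Export all_classical all_reals all_analysis.

Set Implicit Arguments.
Unset Strict Implicit.
Unset Printing Implicit Defensive.

Import Order.TTheory GRing.Theory Num.Theory.

Local Open Scope classical_set_scope.
Local Open Scope ring_scope.

(* R^n is [n.-tuple R], whose measurable structure in the library is the product
   sigma-algebra of the Borel sigma-algebra of R, i.e. the Borel sets of R^n. *)

Section tuple_vectors.
Context {R : realType} {n : nat}.
Implicit Types (x t u : n.-tuple R) (S A T : set (n.-tuple R)).

Definition tdot x u : R := \sum_(i < n) tnth x i * tnth u i.

Definition topp x : n.-tuple R := [tuple - tnth x i | i < n].

Definition origin_symmetric S := S = topp @` S.

Definition sub_scaled A (r : R) T : set (n.-tuple R) :=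
  [set y | exists2 x, A x &
             exists2 t, T t & y = [tuple tnth x i - r * tnth t i | i < n]].

Definition hypercube : set (n.-tuple R) :=
  [set t | forall i, tnth t i = -1 \/ tnth t i = 1].

Definition odd_lattice : set (n.-tuple R) :=
  [set t | forall i, exists k : int, tnth t i = (2 * k + 1)%:~R].

End tuple_vectors.

Section standard_gaussian.
Context {R : realType}.

Definition tcons n (p : measurableTypeR R * n.-tuple R) : n.+1.-tuple R :=
  [tuple of p.1 :: p.2].

Lemma measurable_tcons n : measurable_fun [set: measurableTypeR R * n.-tuple R] (@tcons n).
Proof. by apply: measurable_cons; [exact: measurable_fst|exact: measurable_snd]. Qed.

HB.instance Definition _ n :=
  isMeasurableFun.Build _ _ _ _ (@tcons n) (@measurable_tcons n).

(* The standard Gaussian measure on R^n, i.e. the n-fold product of N(0, 1):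
   the point mass on the single vector of R^0, then the image of
   N(0, 1) \x gauss n under (a, x) |-> a :: x. *)
Fixpoint gauss n : probability (n.-tuple R) R :=
  match n with
  | 0 => [the probability _ _ of dirac [tuple]]
  | m.+1 => [the probability _ _ of
      distribution [the probability _ _ of (normal_prob 0 1 \x gauss m)%E]
                   (@tcons m)]
  end.

Lemma gauss_box n (B : 'I_n -> set R) : (forall i, measurable (B i)) ->
  gauss n [set x | forall i, B i (tnth x i)] =
  (\prod_(i < n) normal_prob 0 1 (B i))%E.
Proof.
elim: n B => [|n IHn] B mB.
  rewrite big_ord0 (_ : [set x | _] = setT) ?probability_setT//.
  by apply/seteqP; split => // x _ [].
rewrite big_ord_recl -IHn => [|i]; last exact: mB.
rewrite /= /distribution /pushforward -product_measure1E.
- congr (_ _); apply/seteqP; split => -[a x] /= h.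
    split => [|i]; first by have := h ord0; rewrite tnth0.
    by have := h (lift ord0 i); rewrite tnthS.
  move=> i; case: (unliftP ord0 i) => [j ->|->]; rewrite ?tnthS ?tnth0.
    exact: h.2.
  exact: h.1.
- exact: mB.
- rewrite (_ : [set x | _] =
    \bigcap_(i in [set: 'I_n]) ((@tnth n R)^~ i @^-1` B (lift ord0 i))).
    apply: fin_bigcap_measurable => [|i _]; first exact: finite_finset.
    rewrite -[X in measurable X]setTI.
    by apply: measurable_tnth => //; exact: mB.
  by apply/seteqP; split => x /= h i; [move=> _|]; exact: h.
Qed.

End standard_gaussian.

Section radius_and_width.
Context {R : realType} {n : nat}.
Implicit Types S T : set (n.-tuple R).
Local Open Scope ereal_scope.

(* [gauss n] is only meaningful on measurable sets, so [detectable] is to be used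
   for T such that A - rT is measurable for measurable A, e.g. T countable. *)
Definition detectable T (r : R) :=
  exists A : set (n.-tuple R),
    [/\ measurable A, ((9 / 10)%R : R)%:E <= gauss n A &
        gauss n (sub_scaled A r T) <= ((1 / 10)%R : R)%:E].

Definition detectability_radius T : \bar R :=
  ereal_sup [set r%:E | r in [set r : R | (0 < r)%R /\ ~ detectable T r]].

Definition gaussian_width S : \bar R :=
  \int[gauss n]_g ereal_sup [set (tdot g u)%:E | u in S].

Definition hits S T := forall t, T t -> exists2 u, S u & (1 <= tdot t u)%R.

Definition focused_width T : \bar R :=
  ereal_inf [set gaussian_width S | S in
    [set S : set (n.-tuple R) | origin_symmetric S /\ hits S T]].

End radius_and_width.

(* Main.v *)
From HB Require Import structures.
Require Import Defs.
From mathcomp Require Import ring lra measurable_realfun.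
Set Implicit Arguments.
Unset Strict Implicit.
Unset Printing Implicit Defensive.
Import Order.TTheory GRing.Theory Num.Theory.
Import numFieldNormedType.Exports HBNNSimple.
Local Open Scope classical_set_scope.
Local Open Scope ring_scope.

(** The focused width of T is at least exp(-1/2), while its detectability radius
    is at most pi sqrt(2) / sqrt(ln n); the theorem is the quotient of the two
    bounds, with C = exp(-1/2) / (pi sqrt 2).

    _Width_ ([gaussian_width_ge]). Let S hit every vertex of the hypercube, say
    <e, u_e> >= 1 with u_e in S. Given a Gaussian vector g, pick a vertex e at
    random by choosing its coordinates independently, e_i = 1 with probability
    (1 + sin g_i) / 2. Then sup_(u in S) <g, u> is at least the conditional mean
    of <g, u_e>. The vertex e is uniform on the hypercube and, given e, the mean
    of g is E[g_1 sin g_1] e; so the expectation is at least E[g_1 sin g_1],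
    which is exp(-1/2). The sine keeps everything smooth: its moments come from
    the same formula for E[cos(s g + a)] ([EcosE]) as the radius bound, whereas
    the signs of the g_i would require half-line integrals.

    _Radius from above_ ([detectable_large], [detectability_radius_le]). An odd
    multiple of r changes the sign of cos(pi x / r). Hence the set A where the sum
    of the cos(pi x_i / r) is positive is disjoint from A - rT. Each term has
    mean exp(-(pi / r)^2 / 2), so by Chebyshev's inequality A has measure at least
    9/10 as soon as n exp(-(pi / r)^2) is at least a constant, that is, as soon as
    r is at least a constant over sqrt(ln n).

    _Radius from below_ ([not_detectable_small]). The radius must also be a
    positive real number for the quotient to be meaningful, so some scale has to
    be undetectable. Translating the Gaussian density by +r and -r and averaging
    loses at most a factor exp(r^2/2); iterating over coordinates,
    the measure of A is at most exp(n r^2/2) times that of A - rT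
    ([gauss_translate_le]), which forbids detection when r = 1/(n+1). *)

(** * The standard normal law as a density *)
Section density.
Context {R : realType}.
Notation mu := (@lebesgue_measure R).
Notation P := (@normal_prob R 0 1).
Notation pdf := (@normal_pdf R 0 1).
Local Open Scope ereal_scope.

(** The density is a Radon-Nikodym derivative of the law, and such derivatives
    agree almost everywhere, so the general change of variables applies. *)
Lemma integral_normal_prob_integrable (f : measurableTypeR R -> \bar R) :
  P.-integrable setT f ->
  \int[P]_x f x = \int[mu]_x (f x * (pdf x)%:E).
Proof.
move=> intf; have mf := measurable_int _ intf.
have dom : P `<< mu := normal_prob_dominates 0 1.
rewrite -(Radon_Nikodym_change_of_variables dom)//=.
apply: ae_eq_integral => //.
- exact: emeasurable_funM.
- apply: emeasurable_funM => //=; apply/measurable_EFinP.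
  exact: measurable_normal_pdf.
- apply: ae_eqe_mul2l => /=.
  rewrite Radon_NikodymE//=.
  case: cid => /= h [h1 h2 h3].
  apply: integral_ae_eq => //=.
  + by apply/measurable_EFinP; exact: measurable_normal_pdf.
  + by move=> E _ mE; rewrite -h3.
Qed.

(** Monotone convergence along simple functions, which are bounded and hence
    integrable, removes the integrability hypothesis. This is what gives access
    to the integrability criterion below. *)
Lemma ge0_integral_normal_prob (f : measurableTypeR R -> \bar R) :
  measurable_fun setT f -> (forall x, 0 <= f x) ->
  \int[P]_x f x = \int[mu]_x (f x * (pdf x)%:E).
Proof.
move=> mf f0.
pose f_ := nnsfun_approx measurableT mf.
have cvgf x : (f_ n x)%:E @[n --> \oo] --> f x.
  exact: (@cvg_nnsfun_approx _ _ _ _ measurableT _ mf).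
have mpdf : measurable_fun setT (fun x => (pdf x)%:E).
  by apply/measurable_EFinP; exact: measurable_normal_pdf.
have pdf0 x : 0 <= (pdf x)%:E by rewrite lee_fin normal_pdf_ge0.
transitivity (lim (\int[P]_x (f_ n x)%:E @[n --> \oo])).
  rewrite -monotone_convergence//=.
  - by apply: eq_integral => x _; apply/esym/cvg_lim => //; exact: cvgf.
  - by move=> n; exact/measurable_EFinP/measurable_funTS.
  - by move=> n x _; rewrite lee_fin.
  - by move=> x _ a b ab; rewrite lee_fin; exact/lefP/nd_nnsfun_approx.
transitivity (lim (\int[mu]_x ((f_ n x)%:E * (pdf x)%:E) @[n --> \oo])).
  apply: congr_lim; apply/funext => n /=.
  rewrite integral_normal_prob_integrable//.
  apply/integrableP; split; first exact/measurable_EFinP/measurable_funTS.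
  have [M [_ Mf]] := simple_bounded (f_ n).
  have Mf1 x : (`|f_ n x| <= M + 1)%R by apply: Mf => //; rewrite ltrDl.
  apply: (@le_lt_trans _ _ (\int[P]_x (M + 1)%:E)).
    apply: ge0_le_integral => //=.
    - exact/measurable_EFinP/measurableT_comp/measurable_funTS.
    - by move=> x _; rewrite lee_fin.
  by rewrite (integral_cst _ measurableT) [X in _ * X](probability_setT P) mule1 ltry.
rewrite -monotone_convergence//=.
- apply: eq_integral => x _; apply/cvg_lim => //.
  by apply: cvgeZr => //; exact: cvgf.
- by move=> n; apply: emeasurable_funM => //; exact/measurable_EFinP/measurable_funTS.
- by move=> n x _; rewrite mule_ge0// lee_fin.
- move=> x _ a b ab; rewrite lee_wpmul2r// lee_fin.
  exact/lefP/nd_nnsfun_approx.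
Qed.

Lemma integrable_normal_prob (f : measurableTypeR R -> R) :
  mu.-integrable setT (fun x => (f x * pdf x)%:E) -> measurable_fun setT f ->
  P.-integrable setT (EFin \o f) /\
  \int[P]_x (f x)%:E = \int[mu]_x (f x * pdf x)%:E.
Proof.
move=> intf mf; have iP : P.-integrable setT (EFin \o f).
  apply/integrableP; split; first exact/measurable_EFinP/measurable_funTS.
  rewrite ge0_integral_normal_prob//.
    move/integrableP: intf => [_]; apply: le_lt_trans.
    rewrite le_eqVlt; apply/orP; left; apply/eqP; apply: eq_integral => x _ /=.
    by rewrite normrM (ger0_norm (normal_pdf_ge0 _ _ _)).
  by apply: measurableT_comp => //; exact/measurable_EFinP.
by split => //; rewrite integral_normal_prob_integrable.
Qed.

End density.

(** * Translation invariance of Lebesgue measure *)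
Definition translate {R : realType} (r : R) (x : measurableTypeR R) :
  measurableTypeR R := x + r.

Lemma measurable_translate {R : realType} (r : R) :
  measurable_fun setT (translate r).
Proof. exact: measurable_funD. Qed.

HB.instance Definition _ (R : realType) (r : R) :=
  isMeasurableFun.Build _ _ _ _ (translate r) (measurable_translate r).

Section lebesgue_translate.
Context {R : realType}.
Notation mu := (@lebesgue_measure R).

Lemma lebesgue_measure_translate (r : R) (A : set (measurableTypeR R)) :
  measurable A -> mu (translate r @^-1` A) = mu A.
Proof.
move=> mA; apply/esym.
rewrite (lebesgue_measure_unique
  (mu := [the measure _ _ of pushforward mu (translate r)]))//.
move=> X [[a b] /= _ <-].
rewrite /pushforward (_ : _ @^-1` _ = `]a - r, b - r]%classic).
  rewrite !lebesgue_measure_itv/= !lte_fin ltrD2r -!EFinB.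
  by case: ifP => // _; congr (_%:E); ring.
by apply/seteqP; split => x /=; rewrite /translate !in_itv/=; lra.
Qed.

Lemma ge0_integral_translate (r : R) (f : measurableTypeR R -> \bar R) :
  measurable_fun setT f -> (forall x, 0 <= f x)%E ->
  (\int[mu]_x f (x + r)%R = \int[mu]_x f x)%E.
Proof.
move=> mf f0.
rewrite -(@ge0_integral_pushforward _ _ _ _ _ (translate r) _ mu setT f)//.
apply: eq_measure_integral => A mA _.
exact: lebesgue_measure_translate.
Qed.
End lebesgue_translate.

(** * Stein's identity *)
Section vanishing.
Context {R : realType}.
Notation mu := (@lebesgue_measure R).

(** The fundamental theorem of calculus on [-n-1, n+1], with the integral over
    the whole line recovered by dominated convergence. *)
Lemma integral_derivative_eq0 (H h : R -> R) :
  (forall x : R, is_derive x 1 H (h x)) -> continuous h ->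
  mu.-integrable setT (EFin \o h) ->
  H n%:R @[n --> \oo] --> 0 -> H (- n%:R) @[n --> \oo] --> 0 ->
  (\int[mu]_x (h x)%:E)%E = 0%E.
Proof.
move=> dH ch ih Hy HNy.
pose I (n : nat) := `[- n.+1%:R, n.+1%:R]%classic : set (measurableTypeR R).
have mI n : measurable (I n) by exact: measurable_itv.
pose h_ n := (EFin \o h) \_ (I n).
have [_ _ cvgh] : [/\ mu.-integrable setT (EFin \o h),
    (\int[mu]_x `|h_ n x - (EFin \o h) x|)%E @[n --> \oo] --> 0%E &
    (\int[mu]_x h_ n x)%E @[n --> \oo] --> (\int[mu]_x (EFin \o h) x)%E].
  apply: (@dominated_convergence _ _ _ mu setT measurableT h_ (EFin \o h)
    (abse \o (EFin \o h))) => //.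
  - move=> n; apply/(measurable_restrictT _ (mI n))/measurable_funTS.
    exact: measurable_int ih.
  - exact: measurable_int ih.
  - apply/aeW => x _; apply: cvg_near_cst; near=> n.
    rewrite /h_ patchE mem_set// /I /= in_itv/= -ler_norml.
    apply: (@le_trans _ _ n%:R); last by rewrite ler_nat.
    by near: n; exact: nbhs_infty_ger.
  - exact: integrable_abse.
  - apply/aeW => x n _; rewrite /h_ patchE; case: ifP => //= _.
    by rewrite normr0 lee_fin.
have FTC n : (\int[mu]_x h_ n x)%E = (H n.+1%:R - H (- n.+1%:R))%:E.
  rewrite /h_ -integral_mkcond /I /=.
  rewrite (@continuous_FTC2 _ h H)//.
  - by rewrite -subr_gt0 opprK addr_gt0.
  - exact: continuous_subspaceT.
  - have cH : continuous H.
      by move=> x; apply/differentiable_continuous/derivable1_diffP; case: (dH x).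
    split.
    + by move=> x _; case: (dH x).
    + by apply: cvg_at_right_filter; exact: cH.
    + by apply: cvg_at_left_filter; exact: cH.
  - by move=> x _; rewrite derive1E; apply: derive_val.
apply: cvg_unique cvgh _ => //.
rewrite (_ : (fun n => _) = EFin \o (fun n => H n.+1%:R - H (- n.+1%:R))); last first.
  by apply/funext => n /=; rewrite FTC.
apply: cvg_EFin; first exact: nearW.
rewrite -[0]subr0; apply: cvgB.
  by rewrite (cvg_shiftS (fun n => H n%:R)).
by rewrite (cvg_shiftS (fun n => H (- n%:R))).
Unshelve. all: end_near. Qed.
End vanishing.

Section normal01.
Context {R : realType}.
Notation mu := (@lebesgue_measure R).
Notation P := (@normal_prob R 0 1).
Notation pdf := (@normal_pdf R 0 1).

Lemma normal_pdf01E x : pdf x = normal_peak 1 * expR (- (x ^+ 2 / 2)).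
Proof.
rewrite normal_pdfE ?oner_eq0// /normal_fun subr0 expr1n mulNr.
by rewrite -[1 *+ 2]/(2 : R).
Qed.

Lemma is_derive_normal_pdf01 (x : R) : is_derive x 1 pdf (- x * pdf x).
Proof.
rewrite (_ : pdf = fun x => normal_peak 1 * expR (- (x ^+ 2 / 2))); last first.
  by apply/funext => y; exact: normal_pdf01E.
apply: is_derive_eq.
rewrite /GRing.scale/=.
by field.
Qed.

(** Since |x| <= 1 + x^2/4 <= exp(x^2/4), the factor x costs at most half of
    the Gaussian decay: what is left is the density of variance 2, which is
    already known to be integrable. *)
Lemma normr_mul_normal_pdf01_le (x : R) :
  `|x * pdf x| <= normal_peak 1 / normal_peak (Num.sqrt 2) *
    normal_pdf 0 (Num.sqrt 2) x.
Proof.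
have s0 : Num.sqrt 2 != 0 :> R by rewrite gt_eqF// sqrtr_gt0.
rewrite normrM (ger0_norm (normal_pdf_ge0 _ _ _)) normal_pdf01E.
rewrite normal_pdfE// mulrA mulfVK; last by rewrite gt_eqF// normal_peak_gt0.
rewrite mulrCA ler_wpM2l ?normal_peak_ge0// /normal_fun subr0 sqr_sqrtr//.
rewrite -ler_pdivlMr ?expR_gt0// -expRN -expRD.
apply: (@le_trans _ _ (1 + x ^+ 2 / 4)).
  rewrite -[x ^+ 2]real_normK ?num_real//.
  have := sqr_ge0 (`|x| / 2 - 1); lra.
apply: le_trans (expR_ge1Dx _) _; rewrite ler_expR.
rewrite -[2 *+ 2]mulr_natr -natrM; lra.
Qed.

Lemma integrable_mul_normal_pdf01 :
  mu.-integrable setT (fun x => (x * pdf x)%:E).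
Proof.
apply: (@le_integrable _ _ _ mu setT measurableT _
  (fun x => (normal_peak 1 / normal_peak (Num.sqrt 2))%:E *
    (normal_pdf 0 (Num.sqrt 2) x)%:E)%E).
- by apply/measurable_EFinP/measurable_funM => //; exact: measurable_normal_pdf.
- move=> x _ /=; rewrite lee_fin (le_trans (normr_mul_normal_pdf01_le x))//.
  exact: ler_norm.
- by apply: integrableZl => //; exact: integrable_normal_pdf.
Qed.

Lemma integrable_id_normal : P.-integrable setT (fun x : measurableTypeR R => x%:E).
Proof. by have [] := @integrable_normal_prob R id integrable_mul_normal_pdf01. Qed.

Lemma normal_pdf01N x : pdf (- x) = pdf x.
Proof. by rewrite !normal_pdf01E sqrrN. Qed.

(** From exp(y) >= 1 + y: any explicit rate tending to 0 is enough to kill the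
    boundary terms in Stein's identity. *)
Lemma normal_pdf01_le (n : nat) : pdf n%:R <= 2 * normal_peak 1 * n.+1%:R^-1.
Proof.
rewrite normal_pdf01E [leRHS]mulrAC [leRHS]mulrC ler_wpM2l ?normal_peak_ge0//.
rewrite expRN -[leRHS]invrK invfM invrK lef_pV2 ?posrE ?expR_gt0 ?mulr_gt0 ?invr_gt0 ?ltr0n//.
apply: le_trans (expR_ge1Dx _).
rewrite -[n.+1%:R]natr1; have := sqr_ge0 (n%:R - 1 / 2 : R); lra.
Qed.

(** E[g f(g)] = E[f'(g)]: the difference of the two integrands, multiplied by
    the density, is the derivative of f times the density, which vanishes at
    both infinities. *)
Lemma stein_identity (f f' : R -> R) (M : R) :
  (forall x : R, is_derive x 1 f (f' x)) -> continuous f' ->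
  (forall x, `|f x| <= M) -> (forall x, `|f' x| <= M) ->
  P.-integrable setT (fun x : measurableTypeR R => (x * f x)%:E) /\
  (\int[P]_x (x * f x)%:E = \int[P]_x (f' x)%:E)%E.
Proof.
move=> df cf' fM f'M.
have cf : continuous f.
  by move=> x; apply/differentiable_continuous/derivable1_diffP; case: (df x).
have cpdf : continuous pdf by apply: continuous_normal_pdf; exact: oner_neq0.
have mf : measurable_fun [set: measurableTypeR R] f by exact: continuous_measurable_fun.
have mf' : measurable_fun [set: measurableTypeR R] f' by exact: continuous_measurable_fun.
have mpdf : measurable_fun [set: measurableTypeR R] pdf := @measurable_normal_pdf _ 0 1.
have M0 : 0 <= M := le_trans (normr_ge0 _) (fM 0).
have i1 : mu.-integrable setT (fun x => (x * f x * pdf x)%:E).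
  apply: (@le_integrable _ _ _ mu setT measurableT _
    (fun x => M%:E * (x * pdf x)%:E)%E).
  - by apply/measurable_EFinP/measurable_funM => //; exact: measurable_funM.
  - move=> x _ /=; rewrite lee_fin mulrAC mulrC !normrM (ger0_norm M0).
    by rewrite ler_wpM2r.
  - by apply: integrableZl => //; exact: integrable_mul_normal_pdf01.
have i2 : mu.-integrable setT (fun x => (f' x * pdf x)%:E).
  apply: (@le_integrable _ _ _ mu setT measurableT _
    (fun x => M%:E * (pdf x)%:E)%E).
  - by apply/measurable_EFinP/measurable_funM.
  - move=> x _ /=; rewrite lee_fin !normrM (ger0_norm M0).
    by rewrite ler_wpM2r.
  - by apply: integrableZl => //; exact: integrable_normal_pdf.
have [j1 ->] := @integrable_normal_prob R (fun x => x * f x) i1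
  (measurable_funM (@measurable_id _ _ _) mf).
have [j2 ->] := @integrable_normal_prob R f' i2 mf'.
split => //.
have cvg0 (a : nat -> R) : (forall n, `|a n| <= M * pdf n%:R) -> a n @[n --> \oo] --> 0.
  move=> aM; apply: norm_cvg0.
  apply: (@squeeze_cvgr _ _ _ _ (fun=> 0) (fun n => (M * (2 * normal_peak 1)) * n.+1%:R^-1)).
  - apply: nearW => n; rewrite normr_ge0/= (le_trans (aM n))// -mulrA.
    by rewrite ler_wpM2l// normal_pdf01_le.
  - exact: cvg_cst.
  - rewrite -[X in _ --> X](mulr0 (M * (2 * normal_peak 1))).
    by apply: cvgMr; exact: cvg_harmonic.
have H0 : (\int[mu]_x (f' x * pdf x - x * f x * pdf x)%:E = 0)%E.
  apply: (@integral_derivative_eq0 R (fun x => f x * pdf x)).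
  - move=> x; have dpdf := is_derive_normal_pdf01 x; apply: is_derive_eq.
    by rewrite /GRing.scale/=; ring.
  - move=> x; apply: (@cvgB _ R^o); first by apply: cvgM; [exact: cf'|exact: cpdf].
    apply: cvgM; last exact: cpdf.
    by apply: cvgM; [exact: cvg_id|exact: cf].
  - by rewrite /comp; under eq_fun do rewrite EFinB; exact: integrableB.
  - apply: cvg0 => n; rewrite normrM (ger0_norm (normal_pdf_ge0 _ _ _)).
    by rewrite ler_wpM2r// normal_pdf_ge0.
  - apply: cvg0 => n; rewrite normrM (ger0_norm (normal_pdf_ge0 _ _ _)) normal_pdf01N.
    by rewrite ler_wpM2r// normal_pdf_ge0.
move: H0; under eq_integral do rewrite EFinB.
rewrite integralB//= => /eqP; rewrite sube_eq ?add0e//.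
- by move=> /eqP ->.
- exact: integrable_fin_num.
Qed.

End normal01.

(** * Trigonometric moments of a normal variable *)
Lemma integrable_bounded_probability d (T : measurableType d) (R : realType)
    (P : probability T R) (f : T -> R) (M : R) :
  measurable_fun setT f -> (forall x, `|f x| <= M) ->
  P.-integrable setT (EFin \o f).
Proof.
move=> mf fM; apply: measurable_bounded_integrable => //.
  by rewrite [X in (X < _)%E](probability_setT P) ltry.
exists M; split; first exact: num_real.
by move=> y My x _ /=; rewrite (le_trans (fM x))// ltW.
Qed.

Section gaussian_cosine.
Context {R : realType}.
Notation P := (@normal_prob R 0 1).

Lemma measurable_cos_affine (s a : R) :
  measurable_fun [set: measurableTypeR R] (fun x => cos (s * x + a)).
Proof.
apply: continuous_measurable_fun => x.
apply: (@continuous_comp _ _ _ (fun x => s * x + a) cos); last exact: continuous_cos.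
by apply: (@cvgD _ R^o); [apply: cvgM; [exact: cvg_cst|exact: cvg_id]|exact: cvg_cst].
Qed.

Lemma integrable_cos_affine (s a : R) :
  P.-integrable setT (fun x : measurableTypeR R => (cos (s * x + a))%:E).
Proof.
apply: (@integrable_bounded_probability _ _ _ P (fun x : measurableTypeR R => cos (s * x + a)) 1).
  exact: measurable_cos_affine.
by move=> x; exact: cos_max.
Qed.

Lemma is_derive_cos_affine (x s a : R) :
  is_derive x 1 (fun x => cos (s * x + a)) (- (s * sin (s * x + a))).
Proof.
apply: is_derive_eq; rewrite /GRing.scale/=; ring.
Qed.

Lemma is_derive_sin_affine (x s a : R) :
  is_derive x 1 (fun x => sin (s * x + a)) (s * cos (s * x + a)).
Proof.
apply: is_derive_eq; rewrite /GRing.scale/=; ring.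
Qed.

Lemma stein_sin_affine (s a : R) :
  P.-integrable setT (fun x : measurableTypeR R => (x * sin (s * x + a))%:E) /\
  \int[P]_x (x * sin (s * x + a)) = s * \int[P]_x (cos (s * x + a)).
Proof.
have [||||ix Ex] := @stein_identity R (fun x => sin (s * x + a))
  (fun x => s * cos (s * x + a)) (1 + `|s|).
- by move=> x; exact: is_derive_sin_affine.
- move=> x; apply: cvgM; first exact: cvg_cst.
  apply: (@continuous_comp _ _ _ (fun x => s * x + a) cos); last exact: continuous_cos.
  by apply: (@cvgD _ R^o); [apply: cvgM; [exact: cvg_cst|exact: cvg_id]|exact: cvg_cst].
- by move=> x; rewrite (le_trans (sin_max _))// lerDl.
- move=> x; rewrite normrM (@le_trans _ _ `|s|)// ?lerDr//.
  by rewrite -[leRHS]mulr1 ler_wpM2l// cos_max.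
split => //; rewrite /Rintegral Ex -RintegralZl//.
exact: integrable_cos_affine.
Qed.

(** The phase a makes one computation serve both for E[cos(s g)] (a = 0) and
    for E[sin g] (a = - pi / 2). *)
Definition Ecos (a s : R) := \int[P]_x cos (s * x + a).

(** Differentiating under the integral gives - E[g sin(s g + a)], which Stein's
    identity turns into - s E[cos(s g + a)]. *)
Lemma is_derive_Ecos (a s : R) : is_derive s 1 (Ecos a) (- s * Ecos a s).
Proof.
pose f (s x : R) := cos (s * x + a).
have df (x y : R) : is_derive x 1 (f ^~ y) (- (y * sin (x * y + a))).
  rewrite (_ : f ^~ y = (fun x => cos (y * x + a))); last first.
    by apply/funext => z; rewrite /f mulrC.
  rewrite [x * y]mulrC; exact: is_derive_cos_affine.
have sI : `]s - 1, s + 1[%classic s by rewrite /= in_itv/=; lra.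
have f1 : forall x, `]s - 1, s + 1[%classic x -> P.-integrable setT (EFin \o f x).
  by move=> x _; exact: integrable_cos_affine.
have d1 (x y : R) : `]s - 1, s + 1[%classic x -> setT y -> derivable (f ^~ y) x 1.
  by move=> _ _; case: (df x y).
have G0 (y : R) : 0 <= `|y| by [].
have iG : P.-integrable setT (EFin \o (fun y : measurableTypeR R => `|y|)).
  exact: (integrable_abse (@integrable_id_normal R)).
have dE (x y : R) : (partial1of2 f) x y = - (y * sin (x * y + a)).
  by rewrite partial1of2E; apply: derive_val.
have Gub (x y : R) : `]s - 1, s + 1[%classic x -> setT y -> `|(partial1of2 f) x y| <= `|y|.
  by move=> _ _; rewrite dE normrN normrM ler_piMr// sin_max.
apply: DeriveDef.
  exact: (derivable_under_integral measurableT sI f1 d1 G0 iG Gub).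
rewrite -derive1E.
rewrite (differentiation_under_integral measurableT sI f1 d1 G0 iG Gub).
under eq_Rintegral do rewrite dE.
have [i1 E1] := stein_sin_affine s a.
rewrite mulNr -E1 -mulN1r -RintegralZl//.
by apply: eq_Rintegral => x _; rewrite mulN1r.
Qed.

(** The differential equation F' = - s F has F(0) exp(-s^2/2) as its only
    solution, because F(s) exp(s^2/2) has zero derivative. *)
Lemma EcosE (a s : R) : Ecos a s = cos a * expR (- (s ^+ 2 / 2)).
Proof.
pose F (s : R) := Ecos a s * expR (s ^+ 2 / 2).
have dF (x : R) : is_derive x 1 F 0.
  have dE := is_derive_Ecos a x.
  by apply: is_derive_eq; rewrite /GRing.scale/=; field.
have := @is_derive_0_is_cst R F s 0 dF.
rewrite /F expr0n/= mul0r expR0 mulr1 => FE.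
apply: (mulIf (lt0r_neq0 (expR_gt0 (s ^+ 2 / 2)))).
rewrite FE -mulrA -expRD addNr expR0 mulr1.
rewrite /Ecos; under eq_Rintegral do rewrite mul0r add0r.
rewrite (@Rintegral_cst _ _ _ P setT measurableT).
by rewrite [X in fine X](probability_setT P) mulr1.
Qed.

Lemma integral_cos_normal (s : R) :
  (\int[P]_x (cos (s * x))%:E = (expR (- (s ^+ 2 / 2)))%:E)%E.
Proof.
have := EcosE 0 s; rewrite cos0 mul1r => <-.
have e : (fun x : measurableTypeR R => (cos (s * x))%:E) = (fun x => (cos (s * x + 0))%:E).
  by apply/funext => x; rewrite addr0.
rewrite e /Ecos /Rintegral fineK//; apply: integrable_fin_num => //.
exact: integrable_cos_affine.
Qed.

Lemma integral_sin_normal : (\int[P]_x (sin x)%:E = 0)%E.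
Proof.
have := EcosE (- (pi / 2)) 1; rewrite cosN cos_pihalf mul0r.
have e : (fun x : measurableTypeR R => (sin x)%:E) = (fun x => (cos (1 * x + (- (pi / 2))))%:E).
  by apply/funext => x; rewrite mul1r -cosBpihalf.
rewrite e /Ecos /Rintegral => h.
by rewrite -[LHS]fineK ?h//; apply: integrable_fin_num => //; exact: integrable_cos_affine.
Qed.

Lemma integral_mul_sin_normal :
  P.-integrable setT (fun x : measurableTypeR R => (x * sin x)%:E) /\
  (\int[P]_x (x * sin x)%:E = (expR (- (1 / 2)))%:E)%E.
Proof.
have [i1 E1] := stein_sin_affine 1 0.
have e : (fun x : measurableTypeR R => (x * sin x)%:E) = (fun x => (x * sin (1 * x + 0))%:E).
  by apply/funext => x; rewrite mul1r addr0.
rewrite e; split => //.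
rewrite -[LHS]fineK; last exact: integrable_fin_num.
congr (_%:E); rewrite [LHS]E1 mul1r.
by have := EcosE 0 1; rewrite /Ecos cos0 expr1n mul1r.
Qed.

Lemma integral_id_normal : (\int[P]_x x%:E = 0)%E.
Proof.
have [x|x|x|_ Ex] := @stein_identity R (fun=> 1) (fun=> 0) 1.
- exact: cvg_cst.
- by rewrite normr1.
- by rewrite normr0.
move: Ex; under eq_integral do rewrite mulr1.
by move=> ->; rewrite integral0.
Qed.

End gaussian_cosine.

(** * Product functions under the Gaussian measure *)
Section product.
Context d1 d2 (T1 : measurableType d1) (T2 : measurableType d2) (R : realType).
Variables (P : {sigma_finite_measure set T1 -> \bar R})
  (Q : {sigma_finite_measure set T2 -> \bar R}).
Local Open Scope ereal_scope.

Lemma integral_prod_mul (f : T1 -> R) (g : T2 -> R) :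
  P.-integrable setT (EFin \o f) -> Q.-integrable setT (EFin \o g) ->
  (P \x Q).-integrable setT (fun z => (f z.1 * g z.2)%:E) /\
  \int[P \x Q]_z (f z.1 * g z.2)%:E =
    \int[P]_x (f x)%:E * \int[Q]_y (g y)%:E.
Proof.
move=> If Ig.
have /measurable_EFinP mf := measurable_int _ If.
have /measurable_EFinP mg := measurable_int _ Ig.
have mfg : measurable_fun setT (fun z : T1 * T2 => (f z.1 * g z.2)%:E).
  apply/measurable_EFinP/measurable_funM.
    by apply: measurableT_comp => //; exact: measurable_fst.
  by apply: measurableT_comp => //; exact: measurable_snd.
have inner (c : R) : \int[Q]_y (c * g y)%:E = c%:E * \int[Q]_y (g y)%:E.
  by under eq_integral do rewrite EFinM; rewrite integralZl.
have gfin : \int[Q]_y (g y)%:E \is a fin_num by exact: integrable_fin_num.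
have Ifg : (P \x Q).-integrable setT (fun z => (f z.1 * g z.2)%:E).
  apply/(@integrable12ltyP _ _ _ _ _ P Q _ mfg).
  have afin : \int[Q]_y `|(g y)%:E| \is a fin_num.
    by apply: integrable_fin_num => //; exact: (integrable_abse Ig).
  rewrite (eq_integral (fun x => `|(f x)%:E| * \int[Q]_y `|(g y)%:E|)); last first.
    move=> x _; rewrite -integralZl//; last exact: (integrable_abse Ig).
    by apply: eq_integral => y _; rewrite EFinM abseM.
  rewrite -(fineK afin) integralZr//; last exact: (integrable_abse If).
  rewrite ltey_eq fin_numM//.
  by apply: integrable_fin_num => //; exact: (integrable_abse If).
split => //.
rewrite -(integral12_prod_meas1 Ifg) /fubini_F/=.
rewrite (eq_integral (fun x => (f x)%:E * \int[Q]_y (g y)%:E)); last by move=> x _.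
by rewrite -(fineK gfin) integralZr.
Qed.
End product.

Section gauss_integrals.
Context {R : realType}.
Notation P := (@normal_prob R 0 1).

Lemma measurable_prod_tnth n (f : 'I_n -> measurableTypeR R -> R) :
  (forall i, measurable_fun setT (f i)) ->
  measurable_fun [set: n.-tuple R] (fun x => \prod_(i < n) f i (tnth x i)).
Proof.
move=> mf; apply: measurable_prod => i _.
apply: measurableT_comp; [exact: mf|exact: measurable_tnth].
Qed.

(** Independence of the coordinates: the form of Fubini's theorem from which
    every n-dimensional expectation below is read off. The values [m] of the
    factors are parameters so that the conclusion can be stated in R. *)
Lemma gauss_prod n (f : 'I_n -> measurableTypeR R -> R) (m : 'I_n -> R) :
  (forall i, P.-integrable setT (EFin \o f i)) ->
  (forall i, (\int[P]_x (f i x)%:E = (m i)%:E)%E) ->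
  (gauss n).-integrable setT (fun x => (\prod_(i < n) f i (tnth x i))%:E) /\
  (\int[gauss n]_x (\prod_(i < n) f i (tnth x i))%:E = (\prod_(i < n) m i)%:E)%E.
Proof.
elim: n f m => [|n IHn] f m If Ef.
  split.
    apply: (@integrable_bounded_probability _ _ _ (gauss 0) _ 1).
      by apply: measurable_prod_tnth => -[].
    by move=> x; rewrite big_ord0 normr1.
  rewrite big_ord0; under eq_integral do rewrite big_ord0.
  rewrite (@integral_cst _ _ _ (gauss 0) setT measurableT).
  by rewrite [X in (_ * X)%E](probability_setT (gauss 0)) mule1.
have [Ig Eg] := IHn (fun j => f (lift ord0 j)) (fun j => m (lift ord0 j))
  (fun j => If _) (fun j => Ef _).
have [Ih Eh] := integral_prod_mul (If ord0) Ig.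
have E (z : measurableTypeR R * n.-tuple R) :
    \prod_(i < n.+1) f i (tnth (tcons z) i) =
    f ord0 z.1 * \prod_(j < n) f (lift ord0 j) (tnth z.2 j).
  rewrite big_ord_recl tnth0; congr (_ * _).
  by apply: eq_bigr => j _; rewrite tnthS.
have mF : measurable_fun [set: n.+1.-tuple R]
    (fun x => (\prod_(i < n.+1) f i (tnth x i))%:E).
  apply/measurable_EFinP; apply: measurable_prod_tnth => i.
  by have /measurable_EFinP := measurable_int _ (If i).
have IF : (P \x gauss n)%E.-integrable (@tcons R n @^-1` setT)
    ((fun x => (\prod_(i < n.+1) f i (tnth x i))%:E) \o @tcons R n).
  rewrite preimage_setT.
  rewrite (_ : _ \o _ = fun z =>
    (f ord0 z.1 * \prod_(j < n) f (lift ord0 j) (tnth z.2 j))%:E)//.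
  by apply/funext => z; rewrite /= E.
split.
  exact: (integrable_pushforward (measurable_tcons (n:=n)) mF IF measurableT).
rewrite [LHS](integral_pushforward (measurable_tcons (n:=n)) mF IF measurableT).
rewrite preimage_setT.
under eq_integral do rewrite /= E.
by rewrite Eh Ef Eg big_ord_recl.
Qed.
End gauss_integrals.

(** * Lower bound on the focused width *)
Section integral_generic.
Context d (T : measurableType d) (R : realType) (mu : {measure set T -> \bar R}).

Lemma integral_sum_real (I : Type) (s : seq I) (F : I -> T -> R) (m : I -> R) :
  (forall i, mu.-integrable setT (fun x => (F i x)%:E)) ->
  (forall i, (\int[mu]_x (F i x)%:E = (m i)%:E)%E) ->
  mu.-integrable setT (fun x => (\sum_(i <- s) F i x)%:E) /\
  (\int[mu]_x (\sum_(i <- s) F i x)%:E = (\sum_(i <- s) m i)%:E)%E.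
Proof.
move=> IF EF; elim: s => [|i s [Is Es]].
  under eq_fun do rewrite big_nil.
  by split; [exact: integrable0|rewrite big_nil integral0].
under eq_fun do rewrite big_cons EFinD.
split; first exact: integrableD.
by rewrite integralD// EF Es big_cons.
Qed.

Lemma integralZl_real (k : R) (f : T -> R) (m : R) :
  mu.-integrable setT (fun x => (f x)%:E) -> (\int[mu]_x (f x)%:E = m%:E)%E ->
  mu.-integrable setT (fun x => (k * f x)%:E) /\
  (\int[mu]_x (k * f x)%:E = (k * m)%:E)%E.
Proof.
move=> If Ef; under eq_fun do rewrite EFinM.
split; first exact: integrableZl.
by rewrite integralZl// Ef.
Qed.

(** The upper function [f] may be non-measurable: the integral of a nonnegative
    function is a supremum over the simple functions below it, so it is monotone
    without measurability. The supremum defining the Gaussian width is used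
    through this lemma, for an arbitrary, possibly uncountable, set S. *)
Lemma integrable_le_integral_ge0 (f : T -> \bar R) (h : T -> R) :
  (forall x, 0 <= f x)%E -> mu.-integrable setT (fun x => (h x)%:E) ->
  (forall x, (h x)%:E <= f x)%E ->
  (\int[mu]_x (h x)%:E <= \int[mu]_x f x)%E.
Proof.
move=> f0 Ih hf.
apply: (@le_trans _ _ (\int[mu]_x (Num.max 0 (h x))%:E)%E).
  apply: le_integral => //.
    rewrite (_ : (fun x => _) = (EFin \o h)^\+%E); first exact: integrable_funepos.
    by apply/funext => x; rewrite funeposE /= EFin_max maxC.
  by move=> x _; rewrite lee_fin le_max lexx orbT.
rewrite !ge0_integralTE//; last by move=> x; rewrite lee_fin le_max lexx.
apply: le_ereal_sup => _ [k /= kh <-]; exists k => //= x.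
by apply: le_trans (kh x) _; rewrite EFin_max ge_max f0 hf.
Qed.

End integral_generic.

Section width.
Context {R : realType}.
Notation P := (@normal_prob R 0 1).
Let c : R := expR (- (1 / 2)).
Let sg (b : bool) : R := (-1) ^+ b.

(** E[sin g] = 0, so a weight has mean 1/2 whatever its sign. *)
Lemma integral_sign_weight b :
  P.-integrable setT (fun x : measurableTypeR R => ((1 + sg b * sin x) / 2)%:E) /\
  (\int[P]_x ((1 + sg b * sin x) / 2)%:E = (1 / 2)%:E)%E.
Proof.
have Isin : P.-integrable setT (fun x : measurableTypeR R => (sin x)%:E).
  apply: (@integrable_bounded_probability _ _ _ P (fun x : measurableTypeR R => sin x) 1).
    by apply: continuous_measurable_fun; exact: continuous_sin.
  by move=> x; exact: sin_max.
have I1 : P.-integrable setT (fun x : measurableTypeR R => 1%:E).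
  by apply: (@integrable_bounded_probability _ _ _ P (fun=> 1) 1) => // x; rewrite normr1.
have E1 : (\int[P]_(x in setT) 1%:E = 1%:E)%E.
  by rewrite (@integral_cst _ _ _ P setT measurableT) mul1e [LHS](probability_setT P).
have e x : (1 + sg b * sin x) / 2 = \sum_(i : bool)
   (if i then 1 / 2 else sg b / 2) * (if i then 1 else sin x).
  by rewrite big_bool /=; field.
have H := @integral_sum_real _ _ _ P bool (index_enum bool)
  (fun i x => (if i then 1 / 2 else sg b / 2) * (if i then 1 else sin x))
  (fun i => if i then 1 / 2 else 0).
under eq_fun do rewrite e.
have [||I E] := H.
- case.
    exact: (@integralZl_real _ _ _ P (1 / 2) _ _ I1 E1).1.
  exact: (@integralZl_real _ _ _ P (sg b / 2) _ _ Isin (@integral_sin_normal R)).1.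
- case.
    by have [_ ->] := @integralZl_real _ _ _ P (1 / 2) _ _ I1 E1; rewrite mulr1.
  have [_ ->] := integralZl_real (sg b / 2) Isin (@integral_sin_normal R).
  by rewrite mulr0.
by split => //; rewrite E big_bool /= addr0.
Qed.

(** E[g] = 0 and E[g sin g] = exp(-1/2), so a weight correlates with the sign it
    carries. *)
Lemma integral_sign_weight_id b :
  P.-integrable setT (fun x : measurableTypeR R => (x * ((1 + sg b * sin x) / 2))%:E) /\
  (\int[P]_x (x * ((1 + sg b * sin x) / 2))%:E = (sg b * c / 2)%:E)%E.
Proof.
have [Isin Esin] := @integral_mul_sin_normal R.
have e x : x * ((1 + sg b * sin x) / 2) = \sum_(i : bool)
   (if i then 1 / 2 else sg b / 2) * (if i then x else x * sin x).
  by rewrite big_bool /=; field.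
have H := @integral_sum_real _ _ _ P bool (index_enum bool)
  (fun i x => (if i then 1 / 2 else sg b / 2) * (if i then x else x * sin x))
  (fun i => if i then 0 else sg b / 2 * c).
under eq_fun do rewrite e.
have [||I E] := H.
- case.
    exact: (@integralZl_real _ _ _ P _ _ 0 (@integrable_id_normal R) (@integral_id_normal R)).1.
  exact: (@integralZl_real _ _ _ P _ _ _ Isin Esin).1.
- case.
    have [_ ->] := integralZl_real (1 / 2) (@integrable_id_normal R)
      (@integral_id_normal R).
    by rewrite mulr0.
  by have [_ ->] := @integralZl_real _ _ _ P (sg b / 2) _ _ Isin Esin.
by split => //; rewrite E big_bool /= add0r mulrAC.
Qed.

Definition sign_vector n (e : {ffun 'I_n -> bool}) : n.-tuple R :=
  [tuple sg (e i) | i < n].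

(** A smooth replacement for the indicator of the orthant of e: given the
    Gaussian point x, choose the i-th sign at random to be that of e with
    probability (1 + sg (e i) sin x_i) / 2; [sign_weight e x] is the probability
    that e is chosen. *)
Definition sign_weight n (e : {ffun 'I_n -> bool}) (x : n.-tuple R) : R :=
  \prod_(i < n) ((1 + sg (e i) * sin (tnth x i)) / 2).

Lemma sign_vector_hypercube n (e : {ffun 'I_n -> bool}) : hypercube (sign_vector e).
Proof. by move=> i; rewrite tnth_mktuple /sg; case: (e i); [left|right]. Qed.

Lemma sign_weight_ge0 n (e : {ffun 'I_n -> bool}) x : 0 <= sign_weight e x.
Proof.
apply: prodr_ge0 => i _; have := sin_max (tnth x i); rewrite ler_norml /sg.
by case: (e i); rewrite ?expr0 ?expr1; lra.
Qed.

(** Expanding the product over i of the sums over the two signs, each equal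
    to 1. *)
Lemma sum_sign_weight n (x : n.-tuple R) :
  \sum_(e : {ffun 'I_n -> bool}) sign_weight e x = 1.
Proof.
rewrite /sign_weight -(bigA_distr_bigA (fun i b => (1 + sg b * sin (tnth x i)) / 2)).
by rewrite big1// => i _; rewrite big_bool /sg /= expr0 expr1; field.
Qed.

(** Only the i-th factor sees the coordinate x_i; it contributes
    sg (e i) c / 2 and the n - 1 others contribute 1/2 each. *)
Lemma integral_sign_weight_coord n (e : {ffun 'I_n -> bool}) (i : 'I_n) :
  (gauss n).-integrable setT (fun x => (sign_weight e x * tnth x i)%:E) /\
  (\int[gauss n]_x (sign_weight e x * tnth x i)%:E =
     (c / 2 ^+ n * tnth (sign_vector e) i)%:E)%E.
Proof.
pose f (j : 'I_n) (y : measurableTypeR R) :=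
  if j == i then y * ((1 + sg (e j) * sin y) / 2) else (1 + sg (e j) * sin y) / 2.
pose m (j : 'I_n) : R := if j == i then sg (e j) * c / 2 else 1 / 2.
have [||I E] := @gauss_prod R n f m.
- move=> j; rewrite /f; case: (j == i).
    exact: (integral_sign_weight_id (e j)).1.
  exact: (integral_sign_weight (e j)).1.
- move=> j; rewrite /f /m; case: (j == i).
    exact: (integral_sign_weight_id (e j)).2.
  exact: (integral_sign_weight (e j)).2.
have fE x : sign_weight e x * tnth x i = \prod_(j < n) f j (tnth x j).
  rewrite /sign_weight (bigD1 i)//= [RHS](bigD1 i)//= {1}/f eqxx.
  rewrite [LHS]mulrC [LHS]mulrA; congr (_ * _); rewrite /f.
  by apply: eq_bigr => j /negbTE ->.
under eq_fun do rewrite fE.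
split => //; rewrite E; congr (_%:E).
rewrite (eq_bigr (fun j => (if j == i then sg (e j) * c else 1) * 2^-1)); last first.
  by move=> j _; rewrite /m; case: (j == i).
rewrite big_split /= prodr_const card_ord -big_mkcond big_pred1_eq tnth_mktuple.
by rewrite exprVn; ring.
Qed.

(** The supremum over S dominates every average of the linear forms attached to
    points of S, in particular the one that gives weight [sign_weight e x] to a
    point u e of S hitting the vertex e. The mean of this average is
    c 2^-n times the sum over e of <e, u e>, hence at least c. *)
Lemma gaussian_width_ge n (S : set (n.-tuple R)) :
  origin_symmetric S -> hits S hypercube -> (c%:E <= gaussian_width S)%E.
Proof.
move=> symS hitS.
have /choice[u uP] : forall e : {ffun 'I_n -> bool}, exists u,
    S u /\ 1 <= tdot (sign_vector e) u.
  by move=> e; have [u Su tu] := hitS _ (sign_vector_hypercube e); exists u.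
pose h x := \sum_(e : {ffun 'I_n -> bool}) \sum_(i < n)
  tnth (u e) i * (sign_weight e x * tnth x i).
have hE x : h x = \sum_(e : {ffun 'I_n -> bool}) sign_weight e x * tdot x (u e).
  apply: eq_bigr => e _; rewrite /tdot mulr_sumr; apply: eq_bigr => i _; ring.
have [||Ih Eh] := @integral_sum_real _ _ _ (gauss n) _
  (index_enum {ffun 'I_n -> bool})
  (fun e x => \sum_(i < n) tnth (u e) i * (sign_weight e x * tnth x i))
  (fun e => \sum_(i < n) tnth (u e) i * (c / 2 ^+ n * tnth (sign_vector e) i)).
- move=> e; apply: (@integral_sum_real _ _ _ (gauss n) _ (index_enum 'I_n)
   _ (fun i => tnth (u e) i * (c / 2 ^+ n * tnth (sign_vector e) i)) _ _).1 => i;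
    have [I E] := integral_sign_weight_coord e i.
    by have [] := integralZl_real (tnth (u e) i) I E.
  by have [] := integralZl_real (tnth (u e) i) I E.
- move=> e; apply: (@integral_sum_real _ _ _ (gauss n) _ (index_enum 'I_n)
   _ (fun i => tnth (u e) i * (c / 2 ^+ n * tnth (sign_vector e) i)) _ _).2 => i;
    have [I E] := integral_sign_weight_coord e i.
    by have [] := integralZl_real (tnth (u e) i) I E.
  by have [] := integralZl_real (tnth (u e) i) I E.
apply: (@le_trans _ _ (\int[gauss n]_x (h x)%:E)%E).
  rewrite Eh lee_fin.
  apply: (@le_trans _ _ (\sum_(e : {ffun 'I_n -> bool}) c / 2 ^+ n)).
    rewrite sumr_const card_ffun card_bool card_ord -[leRHS]mulr_natr natrX.
    by rewrite mulfVK// expf_neq0.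
  apply: ler_sum => e _; have [_ tu] := uP e.
  rewrite -[leLHS]mulr1; apply: le_trans (_ : c / 2 ^+ n * tdot (sign_vector e) (u e) <= _).
    by rewrite ler_wpM2l// divr_ge0 ?expR_ge0// exprn_ge0.
  rewrite le_eqVlt; apply/orP; left; apply/eqP; rewrite /tdot mulr_sumr.
  by apply: eq_bigr => i _; ring.
pose f x := ereal_sup [set (tdot x u)%:E | u in S].
have uf x v : S v -> ((tdot x v)%:E <= f x)%E.
  by move=> Sv; apply: ereal_sup_ubound; exists v.
apply: (@integrable_le_integral_ge0 _ _ _ (gauss n) f) => //.
(* S contains v and - v, and one of the two has a nonnegative product with x. *)
- move=> x; pose v := u [ffun=> true]; have [Sv _] := uP [ffun=> true].
  have SNv : S (topp v) by rewrite symS; exists v.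
  have := uf x _ Sv; have := uf x _ SNv.
  have -> : tdot x (topp v) = - tdot x v.
    by rewrite /tdot -sumrN; apply: eq_bigr => i _; rewrite tnth_mktuple mulrN.
  have [v0|v0] := leP 0 (tdot x v).
    by move=> _; apply: le_trans; rewrite lee_fin.
  by move=> + _; apply: le_trans; rewrite lee_fin oppr_ge0 ltW.
- move=> x; case fx : (f x) => [r| |].
  + rewrite lee_fin hE -[r]mulr1 -(sum_sign_weight x) mulr_sumr; apply: ler_sum => e _.
    rewrite mulrC ler_wpM2r ?sign_weight_ge0//.
    by have [Su _] := uP e; have := uf x _ Su; rewrite fx lee_fin.
  + by rewrite leey.
  + have [Sv _] := uP [ffun=> true].
    by have := uf x _ Sv; rewrite fx.
Qed.

End width.

(** * Detection at large scales *)
Section gauss_variance.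
Context {R : realType}.
Notation P := (@normal_prob R 0 1).

(** Off-diagonal products of independent centred variables have mean zero, so
    the variance of the sum is n times that of one term. *)
Lemma gauss_sum_sqr n (g : measurableTypeR R -> R) (v : R) :
  P.-integrable setT (EFin \o g) -> (\int[P]_x (g x)%:E = 0)%E ->
  P.-integrable setT (fun x => (g x * g x)%:E) ->
  (\int[P]_x (g x * g x)%:E = v%:E)%E ->
  (gauss n).-integrable setT (fun x => ((\sum_(i < n) g (tnth x i)) ^+ 2)%:E) /\
  (\int[gauss n]_x ((\sum_(i < n) g (tnth x i)) ^+ 2)%:E = (n%:R * v)%:E)%E.
Proof.
move=> Ig Eg Ig2 Eg2.
(* Both cases i = j and i <> j are product functions: the k-th factor is
   g^2, g or 1 according to how many of i and j equal k. *)
have pair i j :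
    (gauss n).-integrable setT (fun x => (g (tnth x i) * g (tnth x j))%:E) /\
    (\int[gauss n]_x (g (tnth x i) * g (tnth x j))%:E =
      (if i == j then v else 0)%:E)%E.
  pose f (k : 'I_n) (y : measurableTypeR R) :=
    if k == i then (if k == j then g y * g y else g y)
    else (if k == j then g y else 1).
  pose m (k : 'I_n) : R := if k == i then (if k == j then v else 0)
    else (if k == j then 0 else 1).
  have [||I E] := @gauss_prod R n f m.
  - move=> k; rewrite /f; case: (k == i); case: (k == j) => //.
    apply: (@integrable_bounded_probability _ _ _ P (fun=> 1) 1) => // x.
    by rewrite normr1.
  - move=> k; rewrite /f /m; case: (k == i); case: (k == j) => //.
    by rewrite (@integral_cst _ _ _ P setT measurableT) mul1e [LHS](probability_setT P).
  have fE x : g (tnth x i) * g (tnth x j) = \prod_(k < n) f k (tnth x k).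
    rewrite (bigD1 i)//= {1}/f eqxx; case: eqVneq => [ij|ij].
      rewrite -ij big1 ?mulr1// => k ki; rewrite /f.
      by rewrite -ij (negbTE ki).
    congr (_ * _); rewrite (bigD1 j) 1?eq_sym//= {1}/f eqxx eq_sym (negbTE ij).
    rewrite big1 ?mulr1// => k /andP[ki kj]; rewrite /f.
    by rewrite (negbTE ki) (negbTE kj).
  under eq_fun do rewrite fE.
  split => //; rewrite E; congr (_%:E).
  rewrite (bigD1 i)//= {1}/m eqxx; case: eqVneq => [ij|ij]; last by rewrite mul0r.
  rewrite big1 ?mulr1// => k ki; rewrite /m.
  by rewrite -ij (negbTE ki).
have sqE (x : n.-tuple R) : (\sum_(i < n) g (tnth x i)) ^+ 2 =
    \sum_(i < n) \sum_(j < n) g (tnth x i) * g (tnth x j).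
  by rewrite expr2 mulr_suml; apply: eq_bigr => i _; rewrite mulr_sumr.
under eq_fun do rewrite sqE.
have H i := @integral_sum_real _ _ _ (gauss n) _ (index_enum 'I_n) _ _
  (fun j => (pair i j).1) (fun j => (pair i j).2).
have [I ->] := @integral_sum_real _ _ _ (gauss n) _ (index_enum 'I_n) _ _
  (fun i => (H i).1) (fun i => (H i).2).
split => //; congr (_%:E).
rewrite (eq_bigr (fun=> v)); first by rewrite sumr_const card_ord mulr_natl.
by move=> i _; rewrite -big_mkcond (big_pred1 i)// => j; exact: eq_sym.
Qed.

(** Chebyshev's inequality for the sum of the cos(s x_i), whose mean is n phi
    with phi = exp(-s^2/2). A centred term is at most 2 in absolute value, so
    the variance is at most 4 n, and 4 n / (n phi)^2 <= 1/10 exactly when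
    40 <= n phi^2. *)
Lemma gauss_cos_sum_le0 n (s : R) :
  40 <= n%:R * expR (- s ^+ 2) ->
  measurable [set x : n.-tuple R | \sum_(i < n) cos (s * tnth x i) <= 0] /\
  (gauss n [set x | (\sum_(i < n) cos (s * tnth x i) <= 0)%R] <= (1 / 10)%:E)%E.
Proof.
set phi := expR (- (s ^+ 2 / 2)).
have -> : expR (- s ^+ 2) = phi * phi.
  by rewrite -expRD; congr expR; field.
move=> nphi.
have phi0 : 0 < phi := expR_gt0 _.
have phi1 : phi <= 1.
  by rewrite -[leRHS]expR0 ler_expR oppr_le0 divr_ge0// sqr_ge0.
pose g (y : measurableTypeR R) := cos (s * y) - phi.
have mcos : measurable_fun [set: measurableTypeR R] (fun y => cos (s * y)).
  have := measurable_cos_affine s 0.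
  by under eq_fun do rewrite addr0.
have Icos : P.-integrable setT (fun y : measurableTypeR R => (cos (s * y))%:E).
  apply: (@integrable_bounded_probability _ _ _ P
    (fun y : measurableTypeR R => cos (s * y)) 1) => // y.
  exact: cos_max.
have mg : measurable_fun setT g by exact: measurable_funB.
have gle y : `|g y| <= 2.
  apply: le_trans (ler_normB _ _) _; rewrite (gtr0_norm phi0).
  by rewrite (_ : 2 = 1 + 1)//; apply: lerD; [exact: cos_max|exact: phi1].
have Ig : P.-integrable setT (EFin \o g) := integrable_bounded_probability P mg gle.
have Ic : P.-integrable setT (fun y : measurableTypeR R => phi%:E).
  by apply: (@integrable_bounded_probability _ _ _ P (fun=> phi) phi) => // y; rewrite gtr0_norm.
have Eg : (\int[P]_x (g x)%:E = 0)%E.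
  rewrite /g; under eq_integral do rewrite EFinB.
  rewrite integralB// integral_cos_normal (@integral_cst _ _ _ P setT measurableT).
  by rewrite [X in (_ * X)%E](probability_setT P) mule1 subee.
have g2le y : `|g y * g y| <= 4.
  by rewrite normrM (_ : 4 = 2 * 2) ?ler_pM//; ring.
have mg2 : measurable_fun setT (fun y => g y * g y) by exact: measurable_funM.
have Ig2 : P.-integrable setT (fun y => (g y * g y)%:E) :=
  integrable_bounded_probability P mg2 g2le.
have g2fin : (\int[P]_y (g y * g y)%:E)%E \is a fin_num by exact: integrable_fin_num.
have [IV EV] := gauss_sum_sqr n Ig Eg Ig2 (esym (fineK g2fin)).
set v := fine _ in EV.
have v4 : v <= 4.
  rewrite -lee_fin fineK//.
  have -> : 4%:E = (\int[P]_(x in setT) 4%:E)%E.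
    by rewrite (@integral_cst _ _ _ P setT measurableT) [X in (_ * X)%E](probability_setT P) mule1.
  apply: le_integral => //.
    by apply: (@integrable_bounded_probability _ _ _ P (fun=> 4) 4) => // y; rewrite ger0_norm.
  by move=> y _; rewrite lee_fin (le_trans (ler_norm _)).
set B := [set x | _].
have mS : measurable_fun [set: n.-tuple R] (fun x => \sum_(i < n) cos (s * tnth x i)).
  apply: measurable_sum => i.
  by apply: (measurableT_comp mcos); exact: measurable_tnth.
have mB : measurable B.
  rewrite (_ : B = (fun x : n.-tuple R => \sum_(i < n) cos (s * tnth x i)) @^-1` `]-oo, 0]).
    by rewrite -[X in measurable X]setTI; apply: mS => //; exact: measurable_itv.
  by apply/seteqP; split => x; rewrite /B /= in_itv/=.
split => //.
have n0 : 0 < n%:R * phi.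
  have : 0 < n%:R * (phi * phi) by apply: lt_le_trans nphi.
  by rewrite mulrA pmulr_lgt0.
have fB : gauss n B \is a fin_num by exact: fin_num_measure.
have IB : (gauss n).-integrable setT (fun x => (\1_B x)%:E).
  apply: (@integrable_bounded_probability _ _ _ (gauss n) (\1_B) 1).
    exact: measurable_indic.
  by move=> x; rewrite indicE normr_nat; case: (_ \in _); rewrite ?ler01.
have EB : (\int[gauss n]_x (\1_B x)%:E = (fine (gauss n B))%:E)%E.
  by rewrite integral_indic// setIT fineK.
have [IkB EkB] := integralZl_real ((n%:R * phi) ^+ 2) IB EB.
(* On B the centred sum is at most - n phi, hence its square at least (n phi)^2. *)
have : (((n%:R * phi) ^+ 2 * fine (gauss n B))%:E <= (n%:R * v)%:E)%E.
  rewrite -EkB -EV; apply: le_integral => // x _; rewrite lee_fin.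
  have [xB|xB] := boolP (x \in B); last first.
    by rewrite indicE (negbTE xB) mulr0 sqr_ge0.
  rewrite indicE xB mulr1.
  move: xB; rewrite inE /B /= => xB.
  rewrite /g sumrB sumr_const card_ord -[phi *+ n]mulr_natl.
  rewrite -[leRHS]sqrrN ler_sqr ?nnegrE; [lra|exact: ltW|].
  by move: n0; lra.
rewrite lee_fin -[X in (X <= _)%E](fineK fB) lee_fin => H.
have n0' : 0 < n%:R :> R by move: n0; rewrite pmulr_lgt0.
set p := fine _ in H *.
have p0 : 0 <= p by rewrite fine_ge0.
have {}H : n%:R * (phi * phi) * p <= v.
  rewrite -(ler_pM2l n0'); apply: le_trans H.
  by rewrite le_eqVlt; apply/orP; left; apply/eqP; ring.
have : 40 * p <= n%:R * (phi * phi) * p by rewrite ler_wpM2r.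
lra.
Qed.

End gauss_variance.

Lemma cos_sub_odd_pi {R : realType} (a : R) (k : int) :
  cos (a - pi * (2 * k + 1)%:~R) = - cos a.
Proof.
have alt m b : cos (b + pi * (m.*2.+1)%:R) = - cos b :> R.
  rewrite mulr_natr (alternatingn (@cosDpi R)) -signr_odd /= odd_double.
  by rewrite expr1 mulN1r.
case: k => m.
  have -> : 2 * Posz m + 1 = Posz m.*2.+1 by rewrite intS -mul2n PoszM addrC.
  by rewrite -pmulrn -[X in - cos X](subrK (pi * (m.*2.+1)%:R)) alt opprK.
have -> : 2 * Negz m + 1 = - Posz m.*2.+1.
  by rewrite NegzE !intS -mul2n PoszM; ring.
by rewrite rmorphN /= -pmulrn mulrN opprK alt.
Qed.

Section detect.
Context {R : realType} (n : nat).
Implicit Types (A T : set (n.-tuple R)).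

Lemma measurable_vector_translate (t : n.-tuple R) (r : R) :
  measurable_fun [set: n.-tuple R] (fun y => [tuple tnth y i + r * tnth t i | i < n]).
Proof.
apply/measurable_fun_tnthP => i.
rewrite (_ : _ \o _ = fun y : n.-tuple R => tnth y i + r * tnth t i); last first.
  by apply/funext => y /=; rewrite tnth_mktuple.
by apply: measurable_funD => //; exact: measurable_tnth.
Qed.

(** A - rT is a union of translates of A indexed by T, and T is countable:
    the union is taken over all integer vectors k, with the empty set where
    2 k + 1 is outside T. *)
Lemma measurable_sub_scaled A (r : R) T :
  T `<=` odd_lattice -> measurable A -> measurable (sub_scaled A r T).
Proof.
move=> Todd mA.
pose v (k : {ffun 'I_n -> int}) : n.-tuple R := [tuple (2 * k i + 1)%:~R | i < n].
pose F k := if `[< T (v k) >] then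
  (fun y => [tuple tnth y i + r * tnth (v k) i | i < n]) @^-1` A else set0.
rewrite (_ : sub_scaled A r T = \bigcup_k F k).
  apply: countable_bigcupT_measurable => // k; rewrite /F.
  case: ifP => // _; rewrite -[X in measurable X]setTI.
  exact: measurable_vector_translate.
apply/seteqP; split => y /=.
  move=> [x Ax [t Tt ->]].
  have [k kP] := choice (Todd _ Tt).
  have vt : v (finfun k) = t.
    by apply: eq_from_tnth => i; rewrite tnth_mktuple ffunE kP.
  exists (finfun k) => //; rewrite /F vt asboolT//=.
  rewrite (_ : [tuple _ | _ < n] = x)//.
  by apply: eq_from_tnth => i; rewrite !tnth_mktuple subrK.
move=> [k _]; rewrite /F; case: ifP => // /asboolP Tv /= Ay.
exists [tuple tnth y i + r * tnth (v k) i | i < n] => //.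
exists (v k) => //.
by apply: eq_from_tnth => i; rewrite !tnth_mktuple addrK.
Qed.

(** The test set A is where the sum of the cos(pi x_i / r) is positive. Moving x
    by r times an odd vector changes the sign of each cosine, so that A - rT lies
    in the complement of A for every T made of odd vectors. *)
Lemma detectable_large T (r : R) : T `<=` odd_lattice -> 0 < r ->
  40 <= n%:R * expR (- (pi / r) ^+ 2) -> detectable T r.
Proof.
move=> Todd r0 nr.
have [mB PB] := gauss_cos_sum_le0 nr.
set B := [set x | _] in mB PB.
exists (~` B); split.
- exact: measurableC.
- rewrite probability_setC//.
  have fB : gauss n B \is a fin_num by exact: fin_num_measure.
  move: PB; rewrite -(fineK fB) -EFinB !lee_fin; lra.
- apply: le_trans PB; apply: le_measure; rewrite ?inE//.
    by apply: measurable_sub_scaled => //; exact: measurableC.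
  move=> _ [x Bx [t Tt ->]]; rewrite /B /=.
  rewrite (eq_bigr (fun i => - cos (pi / r * tnth x i))).
    by rewrite sumrN oppr_le0; move: Bx => /negP; rewrite -ltNge; exact: ltW.
  move=> i _; have [k tk] := Todd _ Tt i; rewrite tnth_mktuple tk.
  rewrite mulrBr mulrA divfK ?gt_eqF//.
by rewrite cos_sub_odd_pi.
Qed.

End detect.

(** * No detection at small scales *)
Section shift_comparison.
Context {R : realType}.
Notation mu := (@lebesgue_measure R).
Notation P := (@normal_prob R 0 1).
Notation pdf := (@normal_pdf R 0 1).

(** After dividing by pdf a, this is 2 <= exp(a r) + exp(- a r). *)
Lemma normal_pdf01_translate_le (r a : R) :
  pdf a <= expR (r ^+ 2 / 2) / 2 * (pdf (a - r) + pdf (a + r)).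
Proof.
rewrite !normal_pdf01E -mulrDr [leRHS]mulrCA ler_wpM2l ?normal_peak_ge0//.
rewrite [leRHS]mulrAC mulrDr -!expRD.
have -> : r ^+ 2 / 2 + - ((a - r) ^+ 2 / 2) = - (a ^+ 2 / 2) + a * r by field.
have -> : r ^+ 2 / 2 + - ((a + r) ^+ 2 / 2) = - (a ^+ 2 / 2) - a * r by field.
rewrite !expRD -mulrDr -mulrA ler_peMr ?expR_ge0//.
by have := expR_ge1Dx (a * r); have := expR_ge1Dx (- (a * r)); lra.
Qed.

(** Integrate the previous inequality against F, replace F a by the value of G
    at the translated point, and undo the two translations. *)
Lemma integral_normal_prob_translate_le (r : R) (F G : measurableTypeR R -> \bar R) :
  measurable_fun setT F -> measurable_fun setT G ->
  (forall a, 0 <= F a)%E -> (forall a, 0 <= G a)%E ->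
  (forall a, F a <= G (a - r)%R)%E -> (forall a, F a <= G (a + r)%R)%E ->
  (\int[P]_a F a <= (expR (r ^+ 2 / 2))%:E * \int[P]_a G a)%E.
Proof.
move=> mF mG F0 G0 FG1 FG2.
pose H a := (G a * (pdf a)%:E)%E.
have mpdf : measurable_fun [set: measurableTypeR R] (fun x => (pdf x)%:E).
  by apply/measurable_EFinP; exact: measurable_normal_pdf.
have mH : measurable_fun [set: measurableTypeR R] H by exact: emeasurable_funM.
have pdf0 x : (0 <= (pdf x)%:E)%E by rewrite lee_fin normal_pdf_ge0.
have H0 a : (0 <= H a)%E by rewrite mule_ge0.
have mHt (s : R) : measurable_fun [set: measurableTypeR R] (fun a => H (a + s)).
  exact: (measurableT_comp mH (measurable_translate s)).
set K := expR _.
have K0 : 0 <= K / 2 by rewrite divr_ge0// expR_ge0.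
rewrite !ge0_integral_normal_prob//.
apply: (@le_trans _ _ (\int[mu]_a ((K / 2)%:E * (H (a - r)%R + H (a + r)%R)))%E).
  apply: ge0_le_integral => //=.
  - by move=> a _; rewrite mule_ge0.
  - exact: emeasurable_funM.
  - by apply: emeasurable_funM => //; exact: emeasurable_funD.
  move=> a _; apply: (@le_trans _ _ (F a * (K / 2 * (pdf (a - r) + pdf (a + r)))%:E)%E).
    by rewrite lee_wpmul2l// lee_fin normal_pdf01_translate_le.
  rewrite EFinM muleCA EFinD ge0_muleDr// lee_wpmul2l ?lee_fin//.
  by apply: leeD; apply: lee_wpmul2r.
rewrite ge0_integralZl//=; last 2 first.
  - exact: emeasurable_funD.
  - by move=> a _; rewrite adde_ge0.
rewrite ge0_integralD//= (ge0_integral_translate (- r) mH H0).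
rewrite (ge0_integral_translate r mH H0) -mule2n -mule_natl muleA -EFinM.
by rewrite divfK.
Qed.

(** Induction on n by sections: fixing the first coordinate a of A, the section
    of A at a is moved by the vertices of the (n-1)-cube into the sections of B
    at a - r and at a + r, and the one-dimensional comparison integrates these
    two bounds at the cost of one more factor exp(r^2/2). *)
Lemma gauss_translate_le n (r : R) (A B : set (n.-tuple R)) :
  measurable A -> measurable B ->
  (forall t x, hypercube t -> A x -> B [tuple tnth x i - r * tnth t i | i < n]) ->
  (gauss n A <= (expR (n%:R * (r ^+ 2 / 2)))%:E * gauss n B)%E.
Proof.
elim: n A B => [|n IHn] A B mA mB AB.
  rewrite mul0r expR0 mul1e; apply: le_measure; rewrite ?inE// => x Ax.
  by rewrite [x]tuple0; have := AB [tuple] x; rewrite [X in B X]tuple0; apply=> // -[].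
pose A' := @tcons R n @^-1` A; pose B' := @tcons R n @^-1` B.
have mA' : measurable A'.
  by rewrite -[A']setTI; apply: measurable_tcons.
have mB' : measurable B'.
  by rewrite -[B']setTI; apply: measurable_tcons.
set K := expR (n%:R * (r ^+ 2 / 2)) in IHn *.
have sec (b : bool) a : (gauss n (xsection A' a) <=
    K%:E * gauss n (xsection B' (a - r * (-1) ^+ b)%R))%E.
  apply: IHn => [||t x tc].
  - exact: measurable_xsection.
  - exact: measurable_xsection.
  rewrite /xsection /= !inE /A' /B' /= => Ax.
  pose t' : n.+1.-tuple R := [tuple of (-1) ^+ b :: t].
  have tc' : hypercube t'.
    move=> i; case: (unliftP ord0 i) => [j ->|->]; rewrite ?tnthS ?tnth0//.
    by case: b {t'} => /=; [left|right].
  have := AB _ _ tc' Ax.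
  congr (B _); apply: eq_from_tnth => i; rewrite tnth_mktuple.
  case: (unliftP ord0 i) => [j ->|->]; rewrite ?tnthS ?tnth0//.
  by rewrite tnth_mktuple.
have gE (C : set (n.+1.-tuple R)) : gauss n.+1 C =
   (\int[P]_a gauss n (xsection (@tcons R n @^-1` C) a))%E by [].
rewrite !gE -natr1 mulrDl mul1r expRD mulrC EFinM -muleA -ge0_integralZl//=.
- apply: integral_normal_prob_translate_le => //=.
  + exact: measurable_fun_xsection.
  + by apply: emeasurable_funM => //; exact: measurable_fun_xsection.
  + by move=> a; rewrite mule_ge0// lee_fin expR_ge0.
  + by move=> a; have := sec false a; rewrite expr0 mulr1.
  + by move=> a; have := sec true a; rewrite expr1 mulrN1 opprK.
- exact: measurable_fun_xsection.
Qed.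

(** At scale r = 1/(n+1) the factor exp(n r^2/2) is at most 2, so 9/10 <= 2/10
    would follow from detectability. *)
Lemma not_detectable_small n (T : set (n.-tuple R)) :
  hypercube `<=` T -> T `<=` odd_lattice -> ~ detectable T n.+1%:R^-1.
Proof.
move=> cubeT Todd [A [mA PA PB]].
set r := n.+1%:R^-1 in PB.
have mB := measurable_sub_scaled r Todd mA.
have := @gauss_translate_le n r A (sub_scaled A r T) mA mB.
move=> /(_ _)/wrap[t x tc Ax|].
  by exists x => //; exists t => //; exact: cubeT.
apply/negP; rewrite -ltNge.
apply: lt_le_trans PA.
apply: (@le_lt_trans _ _ ((expR (n%:R * (r ^+ 2 / 2)))%:E * (1 / 10)%:E)%E).
  by rewrite lee_wpmul2l// lee_fin expR_ge0.
rewrite -EFinM lte_fin.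
have : expR (n%:R * (r ^+ 2 / 2)) <= 2; last lra.
have r0 : 0 < r by rewrite invr_gt0 ltr0n.
have nr : n%:R * r <= 1 by rewrite ler_pdivrMr ?ltr0n// mul1r ler_nat.
have r1 : r <= 1 by rewrite invf_le1 ?ltr0n// ler1n.
have nr2 : n%:R * (r ^+ 2 / 2) <= 1 / 2.
  rewrite mulrA ler_wpM2r ?invr_ge0// expr2 mulrA.
  by rewrite mulr_ile1// ?mulr_ge0// ltW.
have := expR_ge1Dx (- (n%:R * (r ^+ 2 / 2))).
set y := n%:R * _ in nr2 *.
rewrite expRN => h.
have e0 := expR_gt0 y.
have : 1 / 2 <= (expR y)^-1 by lra.
by rewrite -[X in _ <= X]mul1r ler_pdivlMr//; lra.
Qed.

End shift_comparison.

(** * The two bounds and their quotient *)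
Section bounds.
Context {R : realType} (n : nat).
Implicit Types T : set (n.-tuple R).

Lemma focused_width_ge T : hypercube `<=` T ->
  ((expR (- (1 / 2)))%:E <= focused_width T)%E.
Proof.
move=> cubeT; apply: le_ereal_inf_tmp => _ [S [symS hitS] <-].
apply: gaussian_width_ge => // t tc; apply: hitS; exact: cubeT.
Qed.

(** A supremum over the empty set would be -oo, and the quotient with it: the
    radius has to be shown to be a positive number before dividing. *)
Lemma detectability_radius_gt0 T :
  hypercube `<=` T -> T `<=` odd_lattice -> (0 < detectability_radius T)%E.
Proof.
move=> cubeT Todd; apply: (@lt_le_trans _ _ (n.+1%:R^-1)%:E).
  by rewrite lte_fin invr_gt0 ltr0n.
apply: ereal_sup_ubound; exists n.+1%:R^-1 => //; split.
  by rewrite /= invr_gt0 ltr0n.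
exact: not_detectable_small.
Qed.

(** Beyond this scale (pi / r)^2 <= ln n / 2, so n exp(-(pi / r)^2) is at least
    the square root of n, and 1600 = 40^2. *)
Lemma detectability_radius_le T : (1600 <= n)%N -> T `<=` odd_lattice ->
  (detectability_radius T <= (pi * Num.sqrt 2 / Num.sqrt (ln n%:R))%:E)%E.
Proof.
move=> n1600 Todd; apply: ge_ereal_sup => _ [r [r0 ndet] <-].
rewrite lee_fin leNgt; apply/negP => rbig; apply: ndet.
apply: detectable_large => //.
have n1 : 1600 <= n%:R :> R by rewrite (ler_nat _ 1600).
have n0 : 0 < n%:R :> R by rewrite ltr0n (leq_trans _ n1600).
have l0 : 0 < ln (n%:R : R) by rewrite ln_gt0// ltr1n (leq_trans _ n1600).
have sl0 : 0 < Num.sqrt (ln n%:R : R) by rewrite sqrtr_gt0.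
have s20 : 0 < Num.sqrt 2 :> R by rewrite sqrtr_gt0.
have pir : (pi / r) ^+ 2 <= ln n%:R / 2.
  have h : pi / r <= Num.sqrt (ln n%:R) / Num.sqrt 2.
    rewrite ler_pdivlMr// mulrAC ler_pdivrMr//.
    by rewrite [leRHS]mulrC -ler_pdivrMr// ltW.
  apply: (@le_trans _ _ ((Num.sqrt (ln n%:R) / Num.sqrt 2) ^+ 2)).
    by rewrite lerXn2r// nnegrE divr_ge0// ltW// pi_gt0.
  by rewrite expr_div_n !sqr_sqrtr// ltW.
apply: (@le_trans _ _ (n%:R * expR (- (ln n%:R / 2)))); last first.
  by rewrite ler_wpM2l// ler_expR lerN2.
have q0 := expR_gt0 (ln (n%:R : R) / 2).
have qq : expR (ln n%:R / 2) * expR (ln n%:R / 2) = n%:R :> R.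
  by rewrite -expRD -splitr lnK.
rewrite -[X in X * _]qq expRN mulfK ?gt_eqF//.
suff : 40 ^+ 2 <= expR (ln (n%:R : R) / 2) ^+ 2.
  by rewrite ler_sqr// nnegrE ltW.
by rewrite [leRHS]expr2 qq -natrX ler_nat.
Qed.
End bounds.

Theorem theorem1 (R : realType) :
  exists (C : R) (n0 : nat), 0 < C /\
    forall n : nat, (n0 <= n)%N ->
    forall T : set (n.-tuple R),
      origin_symmetric T -> hypercube `<=` T -> T `<=` odd_lattice ->
      ((C * Num.sqrt (ln n%:R))%:E <=
         focused_width T / detectability_radius T)%E.
Proof.
pose D : R := pi * Num.sqrt 2.
have D0 : 0 < D by rewrite mulr_gt0 ?pi_gt0 ?sqrtr_gt0.
exists (expR (- (1 / 2)) / D), 1600%N; split.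
  by rewrite divr_gt0 ?expR_gt0.
move=> n n1600 T _ cubeT Todd.
have := focused_width_ge cubeT.
have := detectability_radius_gt0 cubeT Todd.
have := detectability_radius_le n1600 Todd; rewrite -/D.
have L0 : 0 < Num.sqrt (ln (n%:R : R)).
  by rewrite sqrtr_gt0 ln_gt0// ltr1n (leq_trans _ n1600).
case: (detectability_radius T) => [rho| |] //; rewrite lee_fin lte_fin => rhoD rho0 wc.
rewrite inver gt_eqF//.
apply: (@le_trans _ _ ((expR (- (1 / 2)))%:E * (rho^-1)%:E)%E); last first.
  by rewrite lee_wpmul2r// lee_fin invr_ge0 ltW.
rewrite -EFinM lee_fin -mulrA ler_wpM2l ?expR_ge0//.
rewrite mulrC ler_pdivrMr// mulrC ler_pdivlMr// mulrC.
by move: rhoD; rewrite ler_pdivlMr.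
Qed.
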